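(* There is a canonical one-to-one correspondence between exact DGLAs of degree 2 and exact Courant algebras.
   Context: All vector spaces are real. **DGLAs of degree 2.** A graded Lie algebra is a graded vector space $\tilde{\mathfrak g}$ with a degree-preserving bracket satisfying $[x,y]=-(-1)^{kl}[y,x]$ for $|x|=k,|y|=l$ and such that $[x,\cdot]$ is a degree $k$ derivation of the bracket. A differential graded Lie algebra (DGLA) is a graded Lie algebra with a degree 1 map $\delta$, $\delta^2=0$, $\delta[x,y]=[\delta x,y]+(-1)^k[x,\delta y]$. A DGLA of degree 2 is one concentrated in degrees $-2,-1,0$: $\tilde{\mathfrak g}=\mathfrak h[2]\oplus\mathfrak a[1]\oplus\mathfrak g$ ($\mathfrak h$ in degree $-2$, $\mathfrak a$ in degree $-1$, $\mathfrak g$ in degree $0$). Equivalently: a Lie algebra $\mathfrak g$, $\mathfrak g$-modules $\mathfrak a,\mathfrak h$ ($u\cdot a=[u,a]$, $u\cdot h=[u,h]$), a $\mathfrak g$-equivariant symmetric bilinear map $\varpi\colon\mathfrak a\otimes\mathfrak a\to\mathfrak h$ ($\varpi(a_1,a_2)=[a_1,a_2]$), and $\mathfrak g$-equivariant maps $\mathfrak h\xrightarrow{\delta}\mathfrak a\xrightarrow{\delta}\mathfrak g$ with $\delta^2=0$, $\delta\varpi(a_1,a_2)=(\delta a_1)\cdot a_2+(\delta a_2)\cdot a_1$, and $(\delta a)\cdot h=\varpi(a,\delta h)$. It is exact if $0\to\mathfrak h\xrightarrow{\delta}\mathfrak a\xrightarrow{\delta}\mathfrak g\to0$ is a short exact sequence.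 **Courant algebras.** A Courant algebra over a Lie algebra $\mathfrak g$ is a vector space $\mathfrak a$ with a bilinear bracket $[\![\cdot,\cdot]\!]$ and a (linear) map $p\colon\mathfrak a\to\mathfrak g$ such that $[\![a_1,[\![a_2,a_3]\!]]\!]=[\![[\![a_1,a_2]\!],a_3]\!]+[\![a_2,[\![a_1,a_3]\!]]\!]$ and $p([\![a_1,a_2]\!])=[p(a_1),p(a_2)]$. It is exact if $p$ is surjective and $\mathfrak h:=\ker p$ is left-central: $[\![h,a]\!]=0$ for all $h\in\mathfrak h$, $a\in\mathfrak a$. **The canonical correspondence** assigns to an exact DGLA of degree 2 the Courant algebra $p=\delta\colon\mathfrak a\to\mathfrak g$ with bracket $[\![a_1,a_2]\!]=[\delta a_1,a_2]=\delta a_1\cdot a_2$. Here $\mathfrak h$ is identified with $\delta(\mathfrak h)=\ker(\delta\colon\mathfrak a\to\mathfrak g)\subseteq\mathfrak a$ by means of the injective map $\delta$. *)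

(* Defs.v *)
From HB Require Import structures.
From mathcomp Require Import all_boot all_order all_algebra.
From mathcomp Require Import reals.

Set Implicit Arguments.
Unset Strict Implicit.
Unset Printing Implicit Defensive.

Import Order.TTheory GRing.Theory Num.Theory.
Local Open Scope ring_scope.

(* Vector spaces are lmodTypes of arbitrary, possibly infinite, dimension. *)

Record lieAlgebra (R : realType) := LieAlgebra {
  lie_sort :> lmodType R;
  lie_br : lie_sort -> lie_sort -> lie_sort;
  lie_br_linear_l : forall y, linear (lie_br^~ y);
  lie_br_linear_r : forall x, linear (lie_br x);
  lie_br_alt : forall x, lie_br x x = 0;
  lie_br_jacobi : forall x y z,
    lie_br x (lie_br y z) = lie_br (lie_br x y) z + lie_br y (lie_br x z) }.

Record courantAlgebra (R : realType) (g : lieAlgebra R) := CourantAlgebra {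
  ca_sort :> lmodType R;
  ca_br : ca_sort -> ca_sort -> ca_sort;
  ca_p : {linear ca_sort -> g};
  ca_br_linear_l : forall a2, linear (ca_br^~ a2);
  ca_br_linear_r : forall a1, linear (ca_br a1);
  ca_br_leibniz : forall a1 a2 a3,
    ca_br a1 (ca_br a2 a3) = ca_br (ca_br a1 a2) a3 + ca_br a2 (ca_br a1 a3);
  ca_p_br : forall a1 a2, ca_p (ca_br a1 a2) = lie_br (ca_p a1) (ca_p a2) }.

Definition courant_exact (R : realType) (g : lieAlgebra R)
    (C : courantAlgebra g) : Prop :=
  (forall u : g, exists a : C, ca_p C a = u) /\
  (forall h : C, ca_p C h = 0 -> forall a : C, ca_br h a = 0).

Definition courant_iso (R : realType) (g g' : lieAlgebra R)
    (C : courantAlgebra g) (C' : courantAlgebra g')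
    (phi0 : {linear g -> g'}) (phi1 : {linear C -> C'}) : Prop :=
  [/\ bijective phi0, bijective phi1,
      forall u v, phi0 (lie_br u v) = lie_br (phi0 u) (phi0 v),
      forall a b, phi1 (ca_br a b) = ca_br (phi1 a) (phi1 b) &
      forall a, phi0 (ca_p C a) = ca_p C' (phi1 a)].

(* Graded objects are families indexed by int.  The bracket of degrees i and j
   takes values in every degree k equipped with a proof e of i + j = k (and
   similarly for the differential), so that no transport along equalities such
   as i + j = j + i is needed.  As int is an eqType, e is unique and carries
   no information. *)
Record dgla (R : realType) := Dgla {
  dg :> int -> lmodType R;
  dg_br : forall i j k : int, i + j = k -> dg i -> dg j -> dg k;
  dg_d : forall i k : int, i + 1 = k -> {linear dg i -> dg k};
  dg_br_linear_l : forall (i j k : int) (e : i + j = k) (y : dg j),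
    linear ((dg_br e)^~ y);
  dg_br_linear_r : forall (i j k : int) (e : i + j = k) (x : dg i),
    linear (dg_br e x);
  dg_br_antisym : forall (i j k : int) (e : i + j = k) (e' : j + i = k)
      (x : dg i) (y : dg j),
    dg_br e x y = - ((-1) ^ (i * j) *: dg_br e' y x);
  dg_br_derivation : forall (i j k ij ik jk n : int)
      (eij : i + j = ij) (eik : i + k = ik) (ejk : j + k = jk)
      (e1 : i + jk = n) (e2 : ij + k = n) (e3 : j + ik = n)
      (x : dg i) (y : dg j) (z : dg k),
    dg_br e1 x (dg_br ejk y z) =
      dg_br e2 (dg_br eij x y) z
      + (-1) ^ (i * j) *: dg_br e3 y (dg_br eik x z);
  dg_d_square : forall (i j k : int) (e : i + 1 = j) (e' : j + 1 = k)
      (x : dg i),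
    dg_d e' (dg_d e x) = 0;
  dg_d_br : forall (i j k i1 j1 k1 : int)
      (e : i + j = k) (ei : i + 1 = i1) (ej : j + 1 = j1) (ek : k + 1 = k1)
      (e1 : i1 + j = k1) (e2 : i + j1 = k1) (x : dg i) (y : dg j),
    dg_d ek (dg_br e x y) =
      dg_br e1 (dg_d ei x) y + (-1) ^ i *: dg_br e2 x (dg_d ej y) }.

Definition degree2 (R : realType) (D : dgla R) : Prop :=
  forall i : int, i \notin [:: -2; -1; 0] -> forall x : D i, x = 0.

Definition dgla_exact (R : realType) (D : dgla R) : Prop :=
  let dh : D (-2) -> D (-1) := dg_d D (erefl : -2 + 1 = -1 :> int) in
  let da : D (-1) -> D 0 := dg_d D (erefl : -1 + 1 = 0 :> int) in
  [/\ injective dh,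
      forall a, da a = 0 <-> exists h, dh h = a &
      forall u, exists a, da a = u].

Definition dgla_iso (R : realType) (D D' : dgla R)
    (f : forall i : int, {linear D i -> D' i}) : Prop :=
  [/\ forall i, bijective (f i),
      forall (i j k : int) (e : i + j = k) (x : D i) (y : D j),
        f k (dg_br e x y) = dg_br e (f i x) (f j y) &
      forall (i k : int) (e : i + 1 = k) (x : D i),
        f k (dg_d D e x) = dg_d D' e (f i x)].

Section CourantOfDgla.
Variables (R : realType) (D : dgla R).

Let br00 : D 0 -> D 0 -> D 0 := dg_br (erefl : 0 + 0 = 0 :> int).
Let br01 : D 0 -> D (-1) -> D (-1) := dg_br (erefl : 0 + -1 = -1 :> int).
Let p : {linear D (-1) -> D 0} := dg_d D (erefl : -1 + 1 = 0 :> int).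

Fact dgla_br00_alt (x : D 0) : br00 x x = 0.
Proof.
have := dg_br_antisym (erefl : 0 + 0 = 0 :> int) erefl x x.
rewrite mul0r expr0z scale1r -/(br00 x x) => /eqP.
rewrite -addr_eq0 -mulr2n -scaler_nat scaler_eq0 pnatr_eq0 /=.
by move/eqP.
Qed.

Fact dgla_br00_jacobi (x y z : D 0) :
  br00 x (br00 y z) = br00 (br00 x y) z + br00 y (br00 x z).
Proof.
have := @dg_br_derivation R D 0 0 0 0 0 0 0
  erefl erefl erefl erefl erefl erefl x y z.
by rewrite mul0r expr0z scale1r.
Qed.

Definition dgla_lie : lieAlgebra R :=
  @LieAlgebra R (D 0) br00 (dg_br_linear_l _) (dg_br_linear_r _)
    dgla_br00_alt dgla_br00_jacobi.

Definition derived_br (a1 a2 : D (-1)) : D (-1) := br01 (p a1) a2.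

Fact derived_br_linear_l (a2 : D (-1)) : linear (derived_br^~ a2).
Proof.
by move=> c a b; rewrite /derived_br linearP [br01 _ _]dg_br_linear_l.
Qed.

Fact derived_br_linear_r (a1 : D (-1)) : linear (derived_br a1).
Proof. exact: dg_br_linear_r. Qed.

Fact p_derived_br (a1 a2 : D (-1)) : p (derived_br a1 a2) = br00 (p a1) (p a2).
Proof.
have := @dg_d_br R D 0 (-1) (-1) 1 0 0
  erefl erefl erefl erefl erefl erefl (p a1) a2.
rewrite expr0z scale1r /p dg_d_square => ->.
set b := (X in X + _).
suff -> : b = 0 by rewrite add0r.
have := dg_br_linear_l (erefl : 1 + -1 = 0 :> int) a2 (-1) 0 0.
by rewrite scaleN1r oppr0 addr0 scaleN1r addNr.
Qed.

Fact derived_br_leibniz (a1 a2 a3 : D (-1)) :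
  derived_br a1 (derived_br a2 a3) =
  derived_br (derived_br a1 a2) a3 + derived_br a2 (derived_br a1 a3).
Proof.
rewrite {3}/derived_br p_derived_br.
have := @dg_br_derivation R D 0 0 (-1) 0 (-1) (-1) (-1)
  erefl erefl erefl erefl erefl erefl (p a1) (p a2) a3.
by rewrite mul0r expr0z scale1r.
Qed.

Definition courant_of : courantAlgebra dgla_lie :=
  @CourantAlgebra R dgla_lie (D (-1)) derived_br p
    derived_br_linear_l derived_br_linear_r derived_br_leibniz p_derived_br.

End CourantOfDgla.

(* Main.v *)
(* An exact DGLA of degree 2 is determined by delta : a -> g and the bracket
   [g, a]: exactness identifies h with ker delta, the g-action on h is the
   restriction of the one on a because delta is equivariant and injective on h,
   and delta [a1, a2] = [delta a1, a2] + [delta a2, a1] determines the pairing.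
   Hence an isomorphism of the Courant algebras extends uniquely to degree -2.
   Conversely, left-centrality makes u . a := [[s, a]], for any s with p s = u,
   a well-defined action of g on a, and (g, a, ker p) becomes an exact DGLA with
   pairing (a1, a2) |-> [[a1, a2]] + [[a2, a1]]. *)
Require Import Defs.
From HB Require Import structures.
From mathcomp Require Import all_boot all_order all_algebra.
From mathcomp Require Import reals.

Set Implicit Arguments.
Unset Strict Implicit.
Unset Printing Implicit Defensive.

Import Order.TTheory GRing.Theory Num.Theory.
Local Open Scope ring_scope.

(** * Generalities on linear maps, bijections and degrees *)

Lemma linear_map0 (R : pzRingType) (U V : lmodType R) (f : U -> V) :
  linear f -> f 0 = 0.
Proof. by move=> /(_ (-1) 0 0); rewrite !scaleN1r oppr0 addr0 addNr. Qed.

(** [bijective] demands an inverse function; the choice operator of the domain supplies it. *)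
Lemma inj_surj_bijective (U V : choiceType) (f : U -> V) :
  injective f -> (forall v, exists u, f u = v) -> bijective f.
Proof.
move=> f_inj f_surj.
have f_surjb v : exists u, f u == v by have [u <-] := f_surj v; exists u.
have fK v : f (xchoose (f_surjb v)) = v.
  by apply/eqP; exact: xchooseP (f_surjb v).
by exists (fun v => xchoose (f_surjb v)) => // u; apply: f_inj; rewrite fK.
Qed.

Definition linear_of (R : pzRingType) (U V : lmodType R) (f : U -> V)
    (f_lin : linear f) : {linear U -> V} :=
  HB.pack f (GRing.isLinear.Build R U V *:%R f f_lin).

Section DglaBrackets.
Variables (R : realType) (D : dgla R).

Lemma dg_br0l (i j k : int) (e : i + j = k) (y : D j) : dg_br e 0 y = 0.
Proof. exact: linear_map0 (dg_br_linear_l e y). Qed.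

Lemma dg_br0r (i j k : int) (e : i + j = k) (x : D i) : dg_br e x 0 = 0.
Proof. exact: linear_map0 (dg_br_linear_r e x). Qed.

End DglaBrackets.

Lemma degree2P (i : int) : i \notin [:: -2; -1; 0] \/
  [\/ i = 0, i = -1 | i = -2].
Proof.
case: (boolP (i \in _)) => [|]; last by left.
by rewrite !inE => /or3P[] /eqP ->; right;
  [apply: Or33 | apply: Or32 | apply: Or31].
Qed.

(** * Extending an isomorphism of Courant algebras to the DGLAs *)

Section DglaMorphism.
Variables (R : realType) (D D' : dgla R).
Hypotheses (D2 : degree2 D) (Dex : dgla_exact D).
Hypotheses (D'2 : degree2 D') (D'ex : dgla_exact D').
Variables (f0 : {linear D 0 -> D' 0}) (f1 : {linear D (-1) -> D' (-1)}).
Hypothesis f01 : courant_iso (C := courant_of D) (C' := courant_of D') f0 f1.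

Let dh (E : dgla R) : {linear E (-2) -> E (-1)} := dg_d E erefl.
Let da (E : dgla R) : {linear E (-1) -> E 0} := dg_d E erefl.

(** Since [f0] and [f1] commute with delta, [f1] maps ker delta to ker delta, which is the image of
    degree -2 by exactness. The boolean equality lets [xchoose] turn this into a function. *)
Lemma ex_f2 (h : D (-2)) : exists h' : D' (-2), dh D' h' == f1 (dh D h).
Proof.
have [_ kerD' _] := D'ex; have [_ kerD _] := Dex; have [_ _ _ _ f_d] := f01.
have /kerD' [h' h'E] : da D' (f1 (dh D h)) = 0.
  by rewrite -[LHS]f_d [ca_p _ _](kerD _).2 ?linear0 //; exists h.
by exists h'; apply/eqP.
Qed.

Let f2fun h := xchoose (ex_f2 h).

Let d_f2fun h : dh D' (f2fun h) = f1 (dh D h).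
Proof. by apply/eqP; exact: xchooseP (ex_f2 h). Qed.

Lemma f2_linear : linear f2fun.
Proof.
have [inj' _ _] := D'ex.
by move=> c x y; apply: inj'; rewrite -/(dh D') linearP !d_f2fun !linearP.
Qed.

Definition dgla_mor (i : int) : {linear D i -> D' i} :=
  match i with
  | Posz 0 => f0
  | Negz 0 => f1
  | Negz 1 => linear_of f2_linear
  | _ => \0
  end.

Lemma dgla_mor_d (i k : int) (e : i + 1 = k) (x : D i) :
  dgla_mor k (dg_d D e x) = dg_d D' e (dgla_mor i x).
Proof.
have [_ _ _ _ f_d] := f01.
case: (degree2P k) => [/D'2 k0|kE]; first by rewrite [LHS]k0 [RHS]k0.
case: (degree2P i) => [/D2 i0|iE]; first by rewrite (i0 x) !linear0.
(* Only the differentials -1 -> 0 and -2 -> -1 survive: the first is [f_d], the second [d_f2fun]. *)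
case: iE => ?; subst i; case: kE => ?; subst k => //.
Qed.

Lemma dgla_mor_br (i j k : int) (e : i + j = k) (x : D i) (y : D j) :
  dgla_mor k (dg_br e x y) = dg_br e (dgla_mor i x) (dgla_mor j y).
Proof.
have [inj' _ _] := D'ex; have [_ _ surjD] := Dex.
have [_ _ f_lie f_br f_d] := f01.
(* Every [u] is some delta b, and delta b acts on [a] as the Courant bracket of b and [a], which
   [f1] preserves. *)
have br01 (u : D 0) (a : D (-1)) (e01 : 0 + -1 = -1 :> int) :
    f1 (dg_br e01 u a) = dg_br e01 (f0 u) (f1 a).
  have [b <-] := surjD u; rewrite (eq_irrelevance e01 erefl).
  by rewrite [LHS]f_br [LHS]/= /derived_br -[dg_d D' _ _]f_d.
have br02 (u : D 0) (h : D (-2)) (e02 : 0 + -2 = -2 :> int) :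
    f2fun (dg_br e02 u h) = dg_br e02 (f0 u) (f2fun h).
  (* Equivariance of delta: in the Leibniz rule the term with delta [v] drops out, as it has degree
     1. *)
  have dbr (E : dgla R) (E2 : degree2 E) (v : E 0) (l : E (-2)) :
      dh E (dg_br e02 v l) = dg_br erefl v (dh E l).
    rewrite (dg_d_br e02 (erefl : 0 + 1 = 1 :> int)
      (erefl : -2 + 1 = -1 :> int) erefl erefl erefl).
    by rewrite (E2 1 _ (dg_d _ _ _)) // dg_br0l add0r expr0z scale1r.
  by apply: inj'; rewrite -/(dh D') d_f2fun !dbr // d_f2fun br01.
case: (degree2P k) => [/D'2 k0|kE]; first by rewrite [LHS]k0 [RHS]k0.
case: (degree2P i) => [/D2 i0|iE].
  by rewrite (i0 x) !(dg_br0l, linear0).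
case: (degree2P j) => [/D2 j0|jE].
  by rewrite (j0 y) !(dg_br0r, linear0).
case: iE => ?; subst i; case: jE => ?; subst j; case: kE => E;
  move: e; rewrite {k}E => e //; rewrite (eq_irrelevance e erefl).
- exact: f_lie.
- rewrite (dg_br_antisym _ erefl) linearN linearZ.
  by rewrite [RHS](dg_br_antisym _ erefl); congr (- (_ *: _)); exact: br01.
(* Applying the injective delta to the pairing of two elements of degree -1 leaves, by Leibniz,
   brackets of degrees 0 and -1 only; antisymmetry brings them to the form of [br01]. *)
- apply: inj'; rewrite -/(dh D') [LHS]d_f2fun.
  rewrite /dh !(dg_d_br erefl (erefl : -1 + 1 = 0 :> int)
      (erefl : -1 + 1 = 0 :> int) erefl erefl erefl).
  rewrite linearD linearZ br01.
  rewrite (dg_br_antisym _ (erefl : 0 + -1 = -1 :> int) _ (dg_d D _ y)).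
  rewrite (dg_br_antisym _ (erefl : 0 + -1 = -1 :> int) _ (dg_d D' _ _)).
  by rewrite linearN linearZ br01 ![f0 _]f_d.
- rewrite (dg_br_antisym _ erefl) linearN linearZ.
  by rewrite [RHS](dg_br_antisym _ erefl); congr (- (_ *: _)); exact: br02.
Qed.

Lemma dgla_mor_bij (i : int) : bijective (dgla_mor i).
Proof.
have [inj' ker' _] := D'ex; have [inj ker _] := Dex.
have [f0_bij f1_bij _ _ f_d] := f01.
case: (degree2P i) => [i2|[]->].
- have D0 := D2 i2; have D'0 := D'2 i2.
  by exists \0 => x; [rewrite [RHS]D0 | rewrite [LHS]D'0 [RHS]D'0].
- exact: f0_bij.
- exact: f1_bij.
- apply: inj_surj_bijective => [x y xy|h'].
    by apply: inj; apply: (bij_inj f1_bij); rewrite -!d_f2fun; congr (dh D' _).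
  (* A preimage of [h']: pull delta [h'] back along [f1]. Injectivity of [f0] puts the result in ker
     delta, so it is delta of some [h]. *)
  have [g1 f1K g1K] := f1_bij.
  have /ker [h hE] : da D (g1 (dh D' h')) = 0.
    apply: (bij_inj f0_bij); rewrite linear0 [LHS]f_d g1K.
    by apply/ker'; exists h'.
  by exists h; apply: inj'; rewrite [LHS]d_f2fun [dh _ _]hE g1K.
Qed.

Lemma dgla_mor_iso : dgla_iso dgla_mor.
Proof.
by split; [exact: dgla_mor_bij | exact: dgla_mor_br | exact: dgla_mor_d].
Qed.

(** Injectivity of delta on [D' (-2)] forces the degree -2 component from that in degree -1. *)
Lemma dgla_mor_unique (f : forall i : int, {linear D i -> D' i}) :
  dgla_iso f -> f 0 =1 f0 -> f (-1) =1 f1 -> forall i, f i =1 dgla_mor i.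
Proof.
move=> [_ _ f_d] E0 E1 i x; have [inj' _ _] := D'ex.
case: (degree2P i) => [/D'2 i0|iE]; first by rewrite [LHS]i0 [RHS]i0.
case: iE x => -> x; [exact: E0 | exact: E1 |].
by apply: inj'; rewrite -f_d E1 [RHS]d_f2fun.
Qed.

End DglaMorphism.

(** * Antisymmetry in a Lie algebra, and the kernel of p as a vector space *)

Section LieBracket.
Variables (R : realType) (g : lieAlgebra R).

Lemma lie_brC (u v : g) : lie_br u v = - lie_br v u.
Proof.
have Dl (x y z : g) : lie_br (x + y) z = lie_br x z + lie_br y z.
  by have := lie_br_linear_l z 1 x y; rewrite !scale1r.
have Dr (x y z : g) : lie_br x (y + z) = lie_br x y + lie_br x z.
  by have := lie_br_linear_r x 1 y z; rewrite !scale1r.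
have := lie_br_alt (u + v); rewrite Dl !Dr !lie_br_alt addr0 add0r.
by move/eqP; rewrite addr_eq0 => /eqP.
Qed.

End LieBracket.

Section CourantKernel.
Variables (R : realType) (g : lieAlgebra R) (C : courantAlgebra g).

Definition kerp : {pred C} := [pred a | ca_p C a == 0].

Fact kerp_submod_closed : submod_closed kerp.
Proof.
split=> [|c x y]; rewrite !inE ?linear0 // => /eqP x0 /eqP y0.
by rewrite linearP x0 y0 scaler0 addr0.
Qed.

HB.instance Definition _ :=
  GRing.isSubmodClosed.Build R C kerp kerp_submod_closed.

Definition courant_ker : Type := {a : C | a \in kerp}.
HB.instance Definition _ := SubChoice.on courant_ker.
HB.instance Definition _ := [SubChoice_isSubLmodule of courant_ker by <:].

Lemma p_courant_ker (h : courant_ker) : ca_p C (val h) = 0.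
Proof. by apply/eqP; have := valP h. Qed.

End CourantKernel.

Arguments kerp {R g} C.

(** * The DGLA of an exact Courant algebra *)

Section DglaOfCourant.
Variables (R : realType) (g : lieAlgebra R) (C : courantAlgebra g).
Hypothesis Cex : courant_exact C.

Let K : lmodType R := courant_ker C.

(** This inclusion becomes the differential from degree -2 to degree -1. *)
Let kval : {linear K -> C} := val.

Lemma kval_inj : injective kval.
Proof. exact: val_inj. Qed.

Lemma p_kval (h : K) : ca_p C (kval h) = 0.
Proof. exact: p_courant_ker. Qed.

Lemma ca_p_surj (u : g) : exists a : C, ca_p C a == u.
Proof. by have [a <-] := Cex.1 u; exists a. Qed.

Definition ca_act (u : g) (a : C) : C := ca_br (xchoose (ca_p_surj u)) a.

(* Left-centrality makes the action independent of the chosen preimage. *)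
Lemma ca_act_p (a b : C) : ca_act (ca_p C a) b = ca_br a b.
Proof.
set s := xchoose (ca_p_surj (ca_p C a)).
have sE : ca_p C s = ca_p C a by apply/eqP; exact: xchooseP (ca_p_surj _).
have := ca_br_linear_l b (-1) a s.
rewrite (Cex.2 (-1 *: a + s)); last by rewrite linearP sE scaleN1r addNr.
by rewrite scaleN1r => /esym/eqP; rewrite addrC subr_eq0 => /eqP.
Qed.

Lemma ca_act_linear_l (a : C) : linear (ca_act^~ a).
Proof.
move=> c u v; have [x <-] := Cex.1 u; have [y <-] := Cex.1 v.
by rewrite -linearP !ca_act_p ca_br_linear_l.
Qed.

Lemma ca_act_linear_r (u : g) : linear (ca_act u).
Proof. exact: ca_br_linear_r. Qed.

Lemma p_ca_act (u : g) (a : C) : ca_p C (ca_act u a) = lie_br u (ca_p C a).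
Proof. by have [x <-] := Cex.1 u; rewrite ca_act_p ca_p_br. Qed.

Lemma ca_act_br (u : g) (a b : C) :
  ca_act u (ca_br a b) = ca_br (ca_act u a) b + ca_br a (ca_act u b).
Proof. by have [x <-] := Cex.1 u; rewrite !ca_act_p ca_br_leibniz. Qed.

Lemma ca_act_lie (u v : g) (a : C) :
  ca_act u (ca_act v a) = ca_act (lie_br u v) a + ca_act v (ca_act u a).
Proof.
(* With [v] = p x, the bracket of [u] and [v] is p (u . x), so the claim turns into the derivation
   property [ca_act_br]. *)
by have [x <-] := Cex.1 v; rewrite -p_ca_act !ca_act_p ca_act_br.
Qed.

Fact ca_act_ker (u : g) (h : K) : ca_act u (kval h) \in kerp C.
Proof.
rewrite inE p_ca_act p_kval.
by rewrite (linear_map0 (lie_br_linear_r u)).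
Qed.

Definition ker_act (u : g) (h : K) : K :=
  Sub (ca_act u (kval h)) (ca_act_ker u h).

Lemma kval_act (u : g) (h : K) : kval (ker_act u h) = ca_act u (kval h).
Proof. exact: SubK. Qed.

Fact ca_sym_ker (a b : C) : ca_br a b + ca_br b a \in kerp C.
Proof. by rewrite inE linearD /= !ca_p_br (lie_brC (ca_p C a)) addNr. Qed.

Definition ca_sym (a b : C) : K := Sub (ca_br a b + ca_br b a) (ca_sym_ker a b).

Lemma kval_sym (a b : C) : kval (ca_sym a b) = ca_br a b + ca_br b a.
Proof. exact: SubK. Qed.

Lemma ker_act_linear_l (h : K) : linear (ker_act^~ h).
Proof.
by move=> c u v; apply: kval_inj; rewrite linearP !kval_act ca_act_linear_l.
Qed.

Lemma ker_act_linear_r (u : g) : linear (ker_act u).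
Proof.
move=> c h l; apply: kval_inj; rewrite linearP !kval_act linearP.
by rewrite ca_act_linear_r.
Qed.

Lemma ker_act_lie (u v : g) (h : K) :
  ker_act u (ker_act v h) = ker_act (lie_br u v) h + ker_act v (ker_act u h).
Proof. by apply: kval_inj; rewrite linearD !kval_act ca_act_lie. Qed.

Lemma ca_symC (a b : C) : ca_sym a b = ca_sym b a.
Proof. by apply: kval_inj; rewrite !kval_sym addrC. Qed.

Lemma ca_sym_linear_r (a : C) : linear (ca_sym a).
Proof.
move=> c b b'; apply: kval_inj; rewrite linearP !kval_sym.
by rewrite ca_br_linear_l ca_br_linear_r scalerDr addrACA.
Qed.

(** This is the compatibility of the pairing with delta on degree -2; left-centrality kills one of
    the two terms of the symmetrization. *)
Lemma ca_sym_kval (a : C) (h : K) : ca_sym a (kval h) = ker_act (ca_p C a) h.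
Proof.
apply: kval_inj; rewrite kval_act kval_sym ca_act_p.
by rewrite (Cex.2 (kval h)) ?p_kval ?addr0.
Qed.

Lemma ker_act_sym (u : g) (a b : C) :
  ker_act u (ca_sym a b) = ca_sym (ca_act u a) b + ca_sym a (ca_act u b).
Proof.
apply: kval_inj; rewrite linearD kval_act !kval_sym.
have D := linearD (linear_of (ca_act_linear_r u)).
by rewrite [LHS]D /= !ca_act_br [X in _ + X]addrC addrACA.
Qed.

(** [Negz n] is the integer -(n+1), so matching on constructors makes every component compute.
    ['rV[R]_0] is the zero space. *)
Definition cdg (i : int) : lmodType R :=
  match i with
  | Posz 0 => g
  | Negz 0 => C
  | Negz 1 => K
  | _ => 'rV[R]_0
  end.

(** The target degree [k] is free, with value 0 when it is not [i + j]. The minus signs are those of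
    graded antisymmetry, where [i * j] = 0. *)
Definition cdg_br (i j k : int) : cdg i -> cdg j -> cdg k :=
  match i, j, k return cdg i -> cdg j -> cdg k with
  | Posz 0, Posz 0, Posz 0 => fun u v => lie_br u v
  | Posz 0, Negz 0, Negz 0 => fun u a => ca_act u a
  | Negz 0, Posz 0, Negz 0 => fun a u => - ca_act u a
  | Posz 0, Negz 1, Negz 1 => fun u h => ker_act u h
  | Negz 1, Posz 0, Negz 1 => fun h u => - ker_act u h
  | Negz 0, Negz 0, Negz 1 => fun a b => ca_sym a b
  | _, _, _ => fun _ _ => 0
  end.

Definition cdg_d (i k : int) : {linear cdg i -> cdg k} :=
  match i, k return {linear cdg i -> cdg k} with
  | Negz 1, Negz 0 => kval
  | Negz 0, Posz 0 => ca_p C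
  | _, _ => \0
  end.

Lemma cdg_degree2 (i : int) : i \notin [:: -2; -1; 0] ->
  forall x : cdg i, x = 0.
Proof. by case: i => [[|n]|[|[|n]]] //= _ x; rewrite thinmx0 [RHS]thinmx0. Qed.


Lemma cdg_br_linear_l (i j k : int) (y : cdg j) :
  linear ((@cdg_br i j k)^~ y).
Proof.
case: i j k y => [[|?]|[|[|?]]] [[|?]|[|[|?]]] [[|?]|[|[|?]]] //= y c u v;
  rewrite ?(scaler0, addr0) //.
- exact: lie_br_linear_l.
- exact: ca_act_linear_l.
- exact: ker_act_linear_l.
- by rewrite ca_act_linear_r opprD scalerN.
- by rewrite !(ca_symC _ y); exact: ca_sym_linear_r.
- by rewrite ker_act_linear_r opprD scalerN.
Qed.

Lemma cdg_br_linear_r (i j k : int) (x : cdg i) : linear (@cdg_br i j k x).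
Proof.
case: i j k x => [[|?]|[|[|?]]] [[|?]|[|[|?]]] [[|?]|[|[|?]]] //= x c u v;
  rewrite ?(scaler0, addr0) //.
- exact: lie_br_linear_r.
- exact: ca_act_linear_r.
- exact: ker_act_linear_r.
- by rewrite ca_act_linear_l opprD scalerN.
- exact: ca_sym_linear_r.
- by rewrite ker_act_linear_l opprD scalerN.
Qed.

Lemma cdg_br0l (i j k : int) (y : cdg j) : @cdg_br i j k 0 y = 0.
Proof. exact: linear_map0 (@cdg_br_linear_l i j k y). Qed.

Lemma cdg_br0r (i j k : int) (x : cdg i) : @cdg_br i j k x 0 = 0.
Proof. exact: linear_map0 (@cdg_br_linear_r i j k x). Qed.

Lemma cdg_br_antisym (i j k : int) (x : cdg i) (y : cdg j) : i + j = k ->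
  @cdg_br i j k x y = - ((-1) ^ (i * j) *: @cdg_br j i k y x).
Proof.
move=> e.
case: i j k x y e => [[|?]|[|[|?]]] [[|?]|[|[|?]]] [[|?]|[|[|?]]] //= x y e;
  rewrite ?(scaler0, oppr0) ?(mulr0, mul0r, expr0z, scale1r, opprK) //.
- exact: lie_brC.
(* In degrees -1, -1 the sign of [i * j] = 1 cancels the outer minus, so the pairing must be
   symmetric. *)
- by rewrite [_ ^ _]expr1z scaleN1r opprK ca_symC.
Qed.

Lemma cdg_br_derivation (i j k ij ik jk n : int)
    (x : cdg i) (y : cdg j) (z : cdg k) :
  i + j = ij -> i + k = ik -> j + k = jk -> i + jk = n ->
  @cdg_br i jk n x (@cdg_br j k jk y z) =
    @cdg_br ij k n (@cdg_br i j ij x y) z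
    + (-1) ^ (i * j) *: @cdg_br j ik n y (@cdg_br i k ik x z).
Proof.
have actN (u : g) (a : C) : ca_act u (- a) = - ca_act u a.
  by have := linearN (linear_of (ca_act_linear_r u)) a.
have kerN (u : g) (a : K) : ker_act u (- a) = - ker_act u a.
  by have := linearN (linear_of (ker_act_linear_r u)) a.
have symN (a b : C) : ca_sym a (- b) = - ca_sym a b.
  by have := linearN (linear_of (ca_sym_linear_r a)) b.
move=> <- <- <- <-.
case: (boolP (i + (j + k) \in [:: -2; -1; 0])) => [|/cdg_degree2 n0].
  2: by rewrite [LHS]n0 [RHS]n0.
case: (degree2P i) => [/cdg_degree2/(_ x)->|iE].
  by rewrite !(cdg_br0l, cdg_br0r) scaler0 addr0.
case: (degree2P j) => [/cdg_degree2/(_ y)->|jE].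
  by rewrite !(cdg_br0l, cdg_br0r) scaler0 addr0.
case: (degree2P k) => [/cdg_degree2/(_ z)->|kE].
  by rewrite !(cdg_br0l, cdg_br0r) scaler0 addr0.
(* Ten triples of degrees with sum at least -2 remain. Up to antisymmetry each is the Jacobi
   identity, the action law on [C] or [K], or equivariance of the pairing. *)
case: iE => ?; subst i; case: jE => ?; subst j; case: kE => ?; subst k => // _;
  rewrite ?(mulr0, mul0r, expr0z, scale1r) /=.
- exact: lie_br_jacobi.
- exact: ca_act_lie.
- exact: ker_act_lie.
- by rewrite actN (ca_act_lie x z y) opprD addrC.
- exact: ker_act_sym.
- by rewrite kerN (ker_act_lie x z y) opprD addrC.
- by rewrite !actN opprK (ca_act_lie y z) opprD addrCA subrr addr0.
- by rewrite ker_act_sym (ca_symC (- _)) symN (ca_symC z) addKr.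
- rewrite [_ ^ _]expr1z scaleN1r !symN opprK ker_act_sym opprD.
  by rewrite (ca_symC y) addrAC addNr add0r.
- by rewrite !kerN opprK (ker_act_lie y z) opprD addrCA subrr addr0.
Qed.

Lemma cdg_d_square (i j k : int) (x : cdg i) : cdg_d j k (cdg_d i j x) = 0.
Proof.
case: i j k x => [[|i]|[|[|i]]] [[|j]|[|[|j]]] [[|k]|[|[|k]]] //= x.
all: rewrite ?linear0 //.
exact: p_kval.
Qed.

Lemma cdg_d_br (i j k i1 j1 k1 : int) (x : cdg i) (y : cdg j) :
  i + j = k -> i + 1 = i1 -> j + 1 = j1 -> k + 1 = k1 ->
  cdg_d k k1 (@cdg_br i j k x y) =
    @cdg_br i1 j k1 (cdg_d i i1 x) y
    + (-1) ^ i *: @cdg_br i j1 k1 x (cdg_d j j1 y).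
Proof.
move=> <- <- <- <-.
case: (boolP (i + j + 1 \in [:: -2; -1; 0])) => [|/cdg_degree2 n0].
  2: by rewrite [LHS]n0 [RHS]n0.
case: (degree2P i) => [/cdg_degree2/(_ x)->|iE].
  by rewrite linear0 !(cdg_br0l, cdg_br0r) linear0 scaler0 addr0.
case: (degree2P j) => [/cdg_degree2/(_ y)->|jE].
  by rewrite linear0 !(cdg_br0l, cdg_br0r) linear0 scaler0 addr0.
(* Seven pairs remain. Those with sum -3 have a zero left side and amount to [ca_sym_kval]; the pair
   -1, -1 is the definition of the pairing. *)
case: iE => ?; subst i; case: jE => ?; subst j => // _.
all: rewrite ?(mulr0, mul0r, expr0z, scale1r, exprN1, invrN1, scaleN1r) /=.
- by rewrite add0r p_ca_act.
- by rewrite add0r.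
- by rewrite subr0 linearN p_ca_act [RHS]lie_brC.
- by rewrite opprK !ca_act_p.
- by rewrite [ca_sym _ _]ca_sym_kval subrr.
- by rewrite scaler0 addr0.
- rewrite [ca_sym _ _]ca_symC [ca_sym _ _]ca_sym_kval.
  by rewrite -[(-1) ^ -2]/((-1) ^- 2) sqrrN expr1n invr1 scale1r subrr.
Qed.

Definition dgla_of : dgla R :=
  @Dgla R cdg (fun i j k _ => @cdg_br i j k) (fun i k _ => cdg_d i k)
    (fun i j k _ => @cdg_br_linear_l i j k)
    (fun i j k _ => @cdg_br_linear_r i j k)
    (fun i j k e _ x y => cdg_br_antisym x y e)
    (fun i j k ij ik jk n eij eik ejk en _ _ x y z =>
       cdg_br_derivation x y z eij eik ejk en)
    (fun i j k _ _ => @cdg_d_square i j k)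
    (fun i j k i1 j1 k1 e ei ej ek _ _ x y => cdg_d_br x y e ei ej ek).

Lemma dgla_of_exact : dgla_exact dgla_of.
Proof.
split=> [|a|u]; first exact: kval_inj.
  split=> [pa0|[h <-]]; last exact: p_kval.
  have pa : a \in kerp C by apply/eqP.
  by exists (Sub a pa : K); exact: SubK.
by have [a <-] := Cex.1 u; exists a.
Qed.

Lemma courant_of_dgla_of :
  exists (phi0 : {linear dgla_lie dgla_of -> g})
         (phi1 : {linear courant_of dgla_of -> C}), courant_iso phi0 phi1.
Proof.
(* Degrees 0 and -1 of [dgla_of] compute to [g] and [C], so identities serve; the derived bracket is
   the original one by [ca_act_p]. *)
exists (idfun : {linear g -> g}), (idfun : {linear C -> C}).
split=> //; [by exists id | by exists id |].
by move=> a b; rewrite /= /derived_br /= ca_act_p.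
Qed.

End DglaOfCourant.

(** * Exactness and functoriality of the correspondence *)

Section Correspondence.
Variable R : realType.

(** Left-centrality holds because the derived bracket sees its first argument only through delta. *)
Lemma courant_of_exact (D : dgla R) :
  dgla_exact D -> courant_exact (courant_of D).
Proof.
move=> [_ _ surj]; split=> [|h ph0 a]; first exact: surj.
by rewrite /= /derived_br [dg_d _ _ _]ph0 dg_br0l.
Qed.

Lemma courant_of_iso (D D' : dgla R)
    (f : forall i : int, {linear D i -> D' i}) :
  dgla_iso f ->
  courant_iso (C := courant_of D) (C' := courant_of D') (f 0) (f (-1)).
Proof.
move=> [f_bij f_br f_d]; split=> [||u v|a b|a].
- exact: f_bij.
- exact: f_bij.
- exact: f_br.
- by rewrite /= /derived_br f_br f_d.
- exact: f_d.
Qed.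

End Correspondence.

Theorem proposition8p15 (R : realType) :
  [/\ (* the correspondence sends exact DGLAs of degree 2 to exact Courant algebras *)
      forall D : dgla R, degree2 D -> dgla_exact D ->
        courant_exact (courant_of D),
      (* it respects isomorphisms *)
      forall D D' : dgla R, degree2 D -> dgla_exact D ->
        degree2 D' -> dgla_exact D' ->
        forall f : forall i : int, {linear D i -> D' i}, dgla_iso f ->
          courant_iso (C := courant_of D) (C' := courant_of D') (f 0) (f (-1)),
      (* it is injective: an isomorphism of the Courant algebras comes from a
         unique isomorphism of the DGLAs *)
      forall D D' : dgla R, degree2 D -> dgla_exact D ->
        degree2 D' -> dgla_exact D' ->
        forall (phi0 : {linear dgla_lie D -> dgla_lie D'})
               (phi1 : {linear courant_of D -> courant_of D'}),
          courant_iso phi0 phi1 ->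
          exists f : forall i : int, {linear D i -> D' i},
            [/\ dgla_iso f, f 0 =1 phi0, f (-1) =1 phi1 &
                forall f' : forall i : int, {linear D i -> D' i},
                  dgla_iso f' -> f' 0 =1 phi0 -> f' (-1) =1 phi1 ->
                  forall i : int, f' i =1 f i] &
      (* it is surjective *)
      forall (g : lieAlgebra R) (C : courantAlgebra g), courant_exact C ->
        exists D : dgla R, [/\ degree2 D, dgla_exact D &
          exists (phi0 : {linear dgla_lie D -> g})
                 (phi1 : {linear courant_of D -> C}),
            courant_iso phi0 phi1]].
Proof.
split.
- by move=> D _; exact: courant_of_exact.
- by move=> D D' _ _ _ _ f; exact: courant_of_iso.
- move=> D D' D2 Dex D'2 D'ex f0 f1 f01.
  exists (dgla_mor Dex D'ex f01); split=> //.
    exact: dgla_mor_iso.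
  exact: dgla_mor_unique.
- move=> g C Cex; exists (dgla_of Cex); split.
  + exact: cdg_degree2.
  + exact: dgla_of_exact.
  + exact: courant_of_dgla_of.
Qed.
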